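(* Let $d\ge2$ be even, $\alpha>0$, $\beta\in\mathbb{R}$, and let $E=E_4(\alpha,\beta)$ be the $d\times d$ block matrix, with $2\times 2$ blocks, whose diagonal blocks all equal $A=\begin{pmatrix}\alpha&\beta\\-\beta&\alpha\end{pmatrix}$, whose first block-superdiagonal blocks all equal the $2\times2$ identity matrix $I_2$, and whose other blocks are $0$. Define functions $\tau_i,\Phi_i$ on $\mathbb{R}^d$, $1\le i\le d/2$, recursively as follows, for $\xi=(\xi_1,\dots,\xi_d)\in\mathbb{R}^d$: - for $i=1$: $\Phi_1(\xi)=\tau_1(\xi)=(|\xi_1|^2+|\xi_2|^2)^{1/2}$; - for $i\ge2$: $$\tau_i(\xi)=\begin{cases}(|\xi_{2i-1}|^2+|\xi_{2i}|^2)^{1/2}&\text{if }\xi_1=\xi_2=\cdots=\xi_{2i-2}=0,\\ \Phi_{i-1}(\xi)\Big[\big(\Phi_{i-1}(\xi)^{-\alpha^{-1}E^t}\xi\big)_{2i-1}^2+\big(\Phi_{i-1}(\xi)^{-\alpha^{-1}E^t}\xi\big)_{2i}^2\Big]^{1/2}&\text{otherwise,}\end{cases}$$ and $\Phi_i(\xi)=|\tau_1(\xi)|+\cdots+|\tau_i(\xi)|$. Then the function $\rho_4$ defined for all $\xi\in\mathbb{R}^d$ by $\rho_4(\xi)=\Phi_{d/2}(\xi)^{1/\alpha}$ is an $(\mathbb{R}^d,E_4^t(\alpha,\beta))$ pseudo-norm.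
   Context: $M^t$ denotes the transpose of $M$, and $(v)_j$ the $j$-th coordinate of a vector $v$. For $a>0$ and a real square matrix $M$, $a^{M}=\exp(M\log a)$. For a real $d\times d$ matrix $M$ whose eigenvalues all have positive real parts, an $(\mathbb{R}^d,M)$ pseudo-norm is a continuous function $\rho:\mathbb{R}^d\to\mathbb{R}$ that is positive on $\mathbb{R}^d\setminus\{0\}$ and satisfies $\rho(a^{M}x)=a\rho(x)$ for all $x\in\mathbb{R}^d$, $a>0$. *)

(* Defs.v *)
From HB Require Import structures.
From mathcomp Require Import all_boot all_order all_algebra.
From mathcomp Require Import complex.
From mathcomp Require Import all_classical all_reals all_analysis.

Set Implicit Arguments.
Unset Strict Implicit.
Unset Printing Implicit Defensive.

Import Order.TTheory GRing.Theory Num.Theory.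
Import numFieldNormedType.Exports.

Local Open Scope classical_set_scope.
Local Open Scope ring_scope.

Definition expmx (R : realType) (d : nat) (M : 'M[R]_d) : 'M[R]_d :=
  limn (series (fun k : nat => (k`!%:R)^-1 *: M ^+ k)).

(* a^M = exp (M log a); only meaningful for 0 < a. *)
Definition powmx (R : realType) (d : nat) (a : R) (M : 'M[R]_d) : 'M[R]_d :=
  expmx (ln a *: M).

Definition eigen_pos_re (R : realType) (d : nat) (M : 'M[R]_d) : Prop :=
  forall z : R[i],
    eigenvalue (map_mx (real_complex R) M) z -> 0 < complex.Re z.

(* The eigenvalue condition is part of the notion: an (R^d, M) pseudo-norm is
   only defined for matrices M satisfying it. *)
Definition pseudo_norm (R : realType) (d : nat) (M : 'M[R]_d)
    (rho : 'cV[R]_d -> R) : Prop :=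
  [/\ eigen_pos_re M,
      continuous rho,
      forall x : 'cV[R]_d, x != 0 -> 0 < rho x
    & forall (x : 'cV[R]_d) (a : R), 0 < a -> rho (powmx a M *m x) = a * rho x].

Definition blockA (R : realType) (alpha beta : R) : 'M[R]_2 :=
  \matrix_(i < 2, j < 2)
    if i == j then alpha else if (i < j)%N then beta else - beta.

(* Rows and columns are numbered from 0, so the entry (i, j) lies in the 2 x 2
   block (i %/ 2, j %/ 2), at position (i %% 2, j %% 2) inside this block. *)
Definition E4 (R : realType) (d : nat) (alpha beta : R) : 'M[R]_d :=
  \matrix_(i < d, j < d)
    let p : 'I_2 := inord (i %% 2)%N in
    let q : 'I_2 := inord (j %% 2)%N in
    if (j %/ 2 == i %/ 2)%N then blockA alpha beta p q
    else if (j %/ 2 == (i %/ 2).+1)%N then (1%:M : 'M[R]_2) p q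
    else 0.

(* The coordinate (v)_j, with j running from 1 to d. *)
Definition coord1 (R : realType) (d : nat) (v : 'cV[R]_d) (j : nat) : R :=
  if insub j.-1%N is Some k then v k ord0 else 0.

Section Recursion.
Variables (R : realType) (d : nat) (alpha beta : R).
Implicit Types (xi : 'cV[R]_d) (i : nat).

Definition block_norm i (v : 'cV[R]_d) : R :=
  Num.sqrt (coord1 v (2 * i - 1)%N ^+ 2 + coord1 v (2 * i)%N ^+ 2).

(* The case i >= 2 of the definition of tau_i, phi being the value of
   Phi_{i-1} at xi. *)
Definition tau_step i (phi : R) xi : R :=
  if [forall j : 'I_d, (j < 2 * i - 2)%N ==> (xi j ord0 == 0)]
  then block_norm i xi
  else phi *
       block_norm i (powmx phi (- (alpha^-1 *: (E4 d alpha beta)^T)) *m xi).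

(* Phi_i for i >= 1; the value at i = 0 is a dummy. *)
Fixpoint Phi i xi : R :=
  match i with
  | 0 => 0
  | 1 => block_norm 1 xi
  | i'.+1 => Phi i' xi + `|tau_step i (Phi i' xi) xi|
  end.

Definition tau i xi : R :=
  if i == 1%N then block_norm 1 xi else tau_step i (Phi i.-1 xi) xi.

Lemma tau1E xi : tau 1 xi = block_norm 1 xi. Proof. by []. Qed.

Lemma Phi1E xi : Phi 1 xi = tau 1 xi. Proof. by []. Qed.

Lemma tauE i xi : (2 <= i)%N ->
  tau i xi =
  if [forall j : 'I_d, (j < 2 * i - 2)%N ==> (xi j ord0 == 0)]
  then block_norm i xi
  else Phi i.-1 xi *
       block_norm i (powmx (Phi i.-1 xi)
                       (- (alpha^-1 *: (E4 d alpha beta)^T)) *m xi).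
Proof. by case: i => [|[|i]]. Qed.

Lemma PhiE i xi : (1 <= i)%N -> Phi i xi = \sum_(1 <= j < i.+1) `|tau j xi|.
Proof.
elim: i => // -[_ _|i IH _]; first by rewrite big_nat1 ger0_norm ?sqrtr_ge0.
by rewrite big_nat_recr //= -IH.
Qed.

Definition rho4 xi : R := Phi (d %/ 2)%N xi `^ alpha^-1.

End Recursion.

(* Main.v *)
(** Write [E^t = alpha + beta J + N], where [J] rotates each 2 x 2 block, [N]
    moves each block one place down, and the three terms commute. Since
    [exp (t beta J)] preserves the Euclidean norm of each block, the norm of the
    i-th block of [exp (t E^t) x] is [exp (t alpha)] times that of
    [exp (t N) x], which is polynomial in [t] and [x]. Hence [tau_i] is the norm
    of the i-th block of [exp (s N) xi] with [s = - ln Phi_{i-1} / alpha], and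
    this covers both cases of its definition because [ln 0 = 0]. Homogeneity and
    positivity follow by induction on [i]. For continuity where [Phi_i]
    vanishes, one shows in the same induction that each coordinate among the
    first [2 i] is negligible against all powers of [ln Phi_i], using that
    [phi (ln phi)^m] tends to 0 with [phi]. *)
Require Import Defs.
From HB Require Import structures.
From mathcomp Require Import all_boot all_order all_algebra.
From mathcomp Require Import complex.
From mathcomp Require Import all_classical all_reals all_analysis.
From mathcomp Require Import ring lra zify.

Set Implicit Arguments.
Unset Strict Implicit.
Unset Printing Implicit Defensive.

Import Order.TTheory GRing.Theory Num.Theory.
Import numFieldNormedType.Exports.

Local Open Scope classical_set_scope.
Local Open Scope ring_scope.

(** * The matrix exponential *)

Lemma cvg_eqfun (U : topologicalType) (T : Type) (F : set_system T)
    (f g : T -> U) (l : U) :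
  f =1 g -> f x @[x --> F] --> l -> g x @[x --> F] --> l.
Proof. by move=> /funext ->. Qed.

Lemma cvgr_sum (R : realType) (T I : Type) (F : set_system T) {FF : Filter F}
    (r : seq I) (P : pred I) (f : I -> T -> R) (l : I -> R) :
  (forall i, P i -> f i x @[x --> F] --> l i) ->
  \sum_(i <- r | P i) f i x @[x --> F] --> \sum_(i <- r | P i) l i.
Proof. by move=> fl; apply: cvg_big => //; apply: add_continuous. Qed.

Lemma sum_triangle (V : nmodType) (F : nat -> nat -> V) (n : nat) :
  \sum_(0 <= k < n) \sum_(0 <= i < k.+1) F i (k - i)%N =
  \sum_(0 <= i < n) \sum_(0 <= j < n - i) F i j.
Proof.
transitivity (\sum_(0 <= k < n) \sum_(0 <= i < n | (i <= k)%N) F i (k - i)%N).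
  rewrite !big_mkord; apply: eq_bigr => k _.
  by rewrite !big_mkord (big_ord_widen _ (fun i => F i (k - i)%N) (ltn_ord k)).
rewrite (exchange_big_dep_nat predT) //=.
apply: eq_bigr => i _.
rewrite -(big_nat_widenl i 0%N n predT (fun k => F i (k - i)%N)) //.
rewrite -{1}(add0n i) big_addn.
by apply: eq_bigr => j _; rewrite addnK.
Qed.

(* The truncated exponential series, with the central elements [c k] playing
   the role of [1 / k!], so that matrices and scalars are treated alike. *)
Lemma exp_series_cauchy (T : pzRingType) (c : nat -> T) (x y : T) (n : nat) :
    (forall k z, c k * z = z * c k) -> (forall k, c k *+ k`! = 1) ->
    x * y = y * x ->
  (\sum_(0 <= i < n) c i * x ^+ i) * (\sum_(0 <= j < n) c j * y ^+ j) -
    \sum_(0 <= k < n) c k * (x + y) ^+ k =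
  \sum_(0 <= i < n) \sum_(n - i <= j < n) (c i * c j) * (x ^+ i * y ^+ j).
Proof.
move=> cC c_fact cxy.
(* Integers need not be invertible in [T]. Two factors 1 supplied by [c_fact] bring in i! and j!,
   which complete the binomial coefficient to (i + j)!. *)
have c_bin i j : c (i + j)%N *+ 'C(i + j, i) = c i * c j.
  rewrite -[LHS]mulr1 -(c_fact i) -[LHS]mulr1 -(c_fact j).
  rewrite !mulrnAr !mulrnAl -!mulrnA.
  have -> : ('C(i + j, i) * (i`! * j`!) = (i + j)`!)%N.
    by rewrite -(bin_fact (leq_addr j i)) addKn.
  by rewrite -mulrA -mulrnAl c_fact mul1r.
pose F i j := (c i * c j) * (x ^+ i * y ^+ j).
have -> : \sum_(0 <= k < n) c k * (x + y) ^+ k =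
          \sum_(0 <= i < n) \sum_(0 <= j < n - i) F i j.
  rewrite -sum_triangle; apply: eq_bigr => k _.
  rewrite addrC exprDn_comm // big_mkord mulr_sumr; apply: eq_bigr => i _.
  have le_ik : (i <= k)%N by rewrite -ltnS.
  rewrite /F -c_bin subnKC // mulrnAr mulrnAl; congr (_ * _ *+ _).
  by apply/commrX/commr_sym/commrX.
rewrite mulr_suml -sumrB; apply: eq_big_nat => i /andP[_ lt_in].
have FE j : F i j = c i * x ^+ i * (c j * y ^+ j).
  by rewrite /F -!mulrA; congr (_ * _); rewrite !mulrA cC.
rewrite mulr_sumr (big_cat_nat (leq0n (n - i)) (leq_subr i n)) /=.
rewrite addrAC -sumrB [X in X + _]big1 ?add0r; last first.
  by move=> j _; rewrite FE subrr.
by apply: eq_bigr => j _; rewrite -FE.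
Qed.

Section MatrixExponential.
Variables (R : realType) (d : nat).
Implicit Types (A B M : 'M[R]_d) (s t : R).

Definition expmx_part M (n : nat) : 'M[R]_d :=
  \sum_(0 <= k < n) (k`!%:R)^-1 *: M ^+ k.

(** [|M|] is the largest absolute value of an entry, and an entry of a product is a sum of [d]
    terms. The general right factor [B] makes the bound apply to products of powers of two
    matrices. *)
Lemma mulmx_exp_le M B (b : R) (k : nat) :
  (forall i j, `|B i j| <= b) ->
  forall i j, `|(M ^+ k *m B) i j| <= (d%:R * `|M|) ^+ k * b.
Proof.
move=> leB; elim: k => [|k IHk] i j.
  by rewrite expr0 mul1mx expr0 mul1r.
rewrite exprS -mulmxA mxE (le_trans (ler_norm_sum _ _ _)) //.
rewrite exprS -!mulrA mulr_natl -[X in _ *+ X](card_ord d) -sumr_const.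
apply: ler_sum => l _; rewrite normrM ler_pM // ?IHk //.
rewrite [`|M|]mx_normrE.
by apply: (le_bigmax _ (fun ij => `|M ij.1 ij.2|) (i, l)).
Qed.

Lemma exp_mx_le M (k : nat) i j : `|(M ^+ k) i j| <= (d%:R * `|M|) ^+ k.
Proof.
rewrite -[M ^+ k]mulmx1 -[leRHS]mulr1.
apply: mulmx_exp_le => {}i {}j; rewrite mxE.
by case: (i == j); rewrite ?normr0 ?normr1.
Qed.

Lemma mx_cvg (m n : nat) (u : nat -> 'M[R]_(m, n)) (L : 'M[R]_(m, n)) :
  (forall i j, u k i j @[k --> \oo] --> L i j) -> u k @[k --> \oo] --> L.
Proof.
move=> cvgu S [P nbhsP subPS].
suff : \forall k \near \oo, forall i j, P i j (u k i j).
  by apply: filterS => k Pk; apply: subPS.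
by apply: filter_forall => i; apply: filter_forall => j; apply/cvgu/nbhsP.
Qed.

(** Each entry of the series is dominated by the exponential series of the real number d |M|. *)
Lemma expmx_cvg M i j : expmx_part M n i j @[n --> \oo] --> expmx M i j.
Proof.
pose u i j k := ((k`!%:R)^-1 *: M ^+ k) i j.
have cvg_u p q : cvgn (series (u p q)).
  apply: normed_cvg.
  apply: (series_le_cvg _ _ _ (is_cvg_series_exp_coeff (d%:R * `|M|))).
  - by move=> k; rewrite normr_ge0.
  - by move=> k; rewrite /exp_coeff /= divr_ge0 ?exprn_ge0 ?mulr_ge0.
  move=> k; rewrite /u /= mxE normrM ger0_norm ?invr_ge0 // mulrC.
  by rewrite ler_wpM2r ?invr_ge0 // exp_mx_le.
have cvg_part : expmx_part M n @[n --> \oo] -->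
    (\matrix_(i, j) limn (series (u i j)) : 'M[R]_d).
  apply: mx_cvg => p q; rewrite mxE.
  suff -> : (fun n => expmx_part M n p q) = series (u p q) by apply: cvg_u.
  by apply/funext => n; rewrite summxE.
(* [limn] is meaningful only for convergent sequences, so [expmx M] is identified after the
   convergence of the partial sums. *)
have -> : expmx M = \matrix_(i, j) limn (series (u i j)).
  exact: cvg_lim cvg_part.
exact: (cvg_comp _ (fun A : 'M[R]_d => A i j) cvg_part
  (@coord_continuous _ _ _ i j _)).
Qed.

Lemma expmx_unique M B :
  (forall i j, expmx_part M n i j @[n --> \oo] --> B i j) -> expmx M = B.
Proof.
move=> cvgB; apply/matrixP => i j.
exact: (@norm_cvg_unique _ R _ _ _ _ (@expmx_cvg M i j) (cvgB i j)).
Qed.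

Lemma mulmx_cvg (u v : nat -> 'M[R]_d) A B :
  (forall i j, u n i j @[n --> \oo] --> A i j) ->
  (forall i j, v n i j @[n --> \oo] --> B i j) ->
  forall i j, (u n *m v n) i j @[n --> \oo] --> (A *m B) i j.
Proof.
move=> cvgA cvgB i j; rewrite mxE.
under eq_fun do rewrite mxE.
by apply: cvgr_sum => k _; apply: cvgM.
Qed.

Lemma expmx_comm A M : A *m M = M *m A -> A *m expmx M = expmx M *m A.
Proof.
move=> AM; apply/matrixP => i j.
have cvgA p q : A p q @[n --> \oo] --> A p q by apply: cvg_cst.
have h1 := @mulmx_cvg (fun=> A) (expmx_part M) _ _ cvgA (@expmx_cvg M) i j.
have h2 := @mulmx_cvg (expmx_part M) (fun=> A) _ _ (@expmx_cvg M) cvgA i j.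
apply: (@norm_cvg_unique _ R _ _ _ _ h1).
apply: cvg_eqfun h2 => n; congr (fun_of_matrix _ i j).
rewrite mulmx_suml mulmx_sumr; apply: eq_bigr => k _.
by rewrite -scalemxAl -scalemxAr; congr (_ *: _); apply/commr_sym/commrX.
Qed.

Lemma expmx_tr M : expmx M^T = (expmx M)^T.
Proof.
apply: expmx_unique => i j; rewrite mxE.
have h := @expmx_cvg M j i.
apply: cvg_eqfun h => n.
rewrite /expmx_part !summxE; apply: eq_bigr => k _; rewrite !mxE; congr (_ * _).
suff -> : M^T ^+ k = (M ^+ k)^T by rewrite mxE.
elim: k => [|k IHk]; first by rewrite !expr0 trmx1.
by rewrite exprS exprSr trmx_mul IHk.
Qed.

Lemma expmx_scalar t : expmx t%:M = (expR t)%:M :> 'M[R]_d.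
Proof.
apply: expmx_unique => i j.
have h : series (exp_coeff t) n *+ (i == j) @[n --> \oo] --> (expR t)%:M i j.
  by rewrite mxE; apply: cvgMn; apply: is_cvg_series_exp_coeff.
apply: cvg_eqfun h => n.
rewrite /expmx_part summxE /series /= -sumrMnl; apply: eq_bigr => k _.
rewrite mxE; suff -> : t%:M ^+ k = (t ^+ k)%:M :> 'M[R]_d.
  by rewrite mxE mulrnAr mulrC.
by elim: k => // k IHk; rewrite !exprS IHk [in RHS]scalar_mxM.
Qed.

Lemma expmx_nilpotent M (n : nat) :
  M ^+ n = 0 -> expmx M = expmx_part M n.
Proof.
move=> Mn; apply: expmx_unique => i j.
apply: cvg_near_cst; exists n => // m /= le_nm.
rewrite /expmx_part (big_cat_nat (leq0n n) le_nm) /= [X in _ + X]big_nat.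
rewrite [X in _ + X]big1 ?addr0 // => k /andP[le_nk _].
by rewrite -(subnK le_nk) exprD Mn mulr0 scaler0.
Qed.

(** Entry by entry, the defect of the truncated Cauchy product is at most the same defect for the
    real numbers d |A| and d |B|, which tends to 0 by [expRD]. *)
Lemma expmxD A B : A *m B = B *m A -> expmx (A + B) = expmx A *m expmx B.
Proof.
move=> cAB; apply: expmx_unique => i j.
set a : R := d%:R * `|A|; set b : R := d%:R * `|B|.
have a0 : 0 <= a by rewrite mulr_ge0.
have b0 : 0 <= b by rewrite mulr_ge0.
pose S (x : R) n := \sum_(0 <= k < n) (k`!%:R)^-1 * x ^+ k.
have cvgS x : S x n @[n --> \oo] --> expR x.
  apply: cvg_eqfun (is_cvg_series_exp_coeff x) => n.
  by apply: eq_bigr => k _; rewrite mulrC.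
have fact_neq0 k : k`!%:R != 0 :> R by rewrite pnatr_eq0 -lt0n fact_gt0.
pose err n := \sum_(0 <= i < n) \sum_(n - i <= j < n)
  (((i`!%:R)^-1 * (j`!%:R)^-1) *: (A ^+ i *m B ^+ j)) : 'M[R]_d.
have errE n : expmx_part A n *m expmx_part B n - expmx_part (A + B) n = err n.
  have := @exp_series_cauchy 'M[R]_d (fun k => (k`!%:R^-1)%:M) A B n.
  have sE M : \sum_(0 <= k < n) (k`!%:R^-1)%:M * M ^+ k = expmx_part M n.
    by apply: eq_bigr => k _; rewrite -mul_scalar_mx.
  rewrite !sE => -> //; last first.
  - by move=> k; rewrite -scaler_nat scale_scalar_mx mulfV.
  - by move=> k z; apply: comm_scalar_mx.
  apply: eq_bigr => k _; apply: eq_bigr => l _.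
  by rewrite -mul_scalar_mx scalar_mxM.
have errS n : \sum_(0 <= i < n) \sum_(n - i <= j < n)
    ((i`!%:R)^-1 * (j`!%:R)^-1) * (a ^+ i * b ^+ j) =
    S a n * S b n - S (a + b) n.
  rewrite (@exp_series_cauchy R (fun k => (k`!%:R)^-1) a b n) //.
  - by move=> k z; rewrite mulrC.
  - by move=> k; rewrite -[LHS]mulr_natr mulVf.
  - by rewrite mulrC.
have err_le n : `|err n i j| <= S a n * S b n - S (a + b) n.
  rewrite -errS /err summxE (le_trans (ler_norm_sum _ _ _)) //.
  rewrite ler_sum // => k _.
  rewrite summxE (le_trans (ler_norm_sum _ _ _)) // ler_sum // => l _.
  rewrite mxE normrM ger0_norm ?mulr_ge0 ?invr_ge0 // ler_wpM2l //.
  by apply: mulmx_exp_le => p q; apply: exp_mx_le.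
have err0 : err n i j @[n --> \oo] --> 0.
  apply/norm_cvg0P.
  apply: (@squeeze_cvgr _ _ _ _ (fun=> 0)
    (fun n => S a n * S b n - S (a + b) n)).
  - by apply: nearW => n; rewrite normr_ge0 err_le.
  - exact: cvg_cst.
  rewrite -(subrr (expR (a + b))) {1}expRD.
  by apply: cvgB => //; apply: cvgM.
rewrite -[X in _ --> X]subr0.
have cvgAB := @mulmx_cvg _ _ _ _ (@expmx_cvg A) (@expmx_cvg B) i j.
apply: cvg_eqfun (cvgB cvgAB err0) => n.
have -> : expmx_part (A + B) n = expmx_part A n *m expmx_part B n - err n.
  by rewrite -errE subKr.
by rewrite [RHS]mxE; congr (_ + _); rewrite mxE.
Qed.

Lemma expmx0 : expmx (0 : 'M[R]_d) = 1%:M.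
Proof. by have := expmx_scalar 0; rewrite expR0 raddf0. Qed.

Lemma expmxDZ s t M : expmx ((s + t) *: M) = expmx (s *: M) *m expmx (t *: M).
Proof.
by rewrite scalerDl expmxD // -!scalemxAl -!scalemxAr !scalerA mulrC.
Qed.

End MatrixExponential.

(** * The decomposition of [E^t] *)

Lemma scalemx_comm (R : comPzRingType) (d : nat) (A B : 'M[R]_d) (s t : R) :
  A *m B = B *m A -> (s *: A) *m (t *: B) = (t *: B) *m (s *: A).
Proof.
by move=> AB; rewrite -!scalemxAl -!scalemxAr AB !scalerA [t * s]mulrC.
Qed.

Section WeightedShift.
Variables (R : realType) (d : nat).
Implicit Types (v w : 'cV[R]_d) (c : nat -> R) (f : nat -> nat).

(* The [k]-th coordinate of [v], numbered from 0, and 0 when [d <= k]. *)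
Definition cpt v (k : nat) : R := coord1 v k.+1.

Lemma cpt_ord v (i : 'I_d) : cpt v i = v i ord0.
Proof. by rewrite /cpt /coord1 /= valK. Qed.

Lemma cpt_oversize v k : (d <= k)%N -> cpt v k = 0.
Proof. by move=> le_dk; rewrite /cpt /coord1 /= insubF // ltnNge le_dk. Qed.

Lemma cptD v w k : cpt (v + w) k = cpt v k + cpt w k.
Proof.
have [lt_kd|le_dk] := ltnP k d; last by rewrite !cpt_oversize ?addr0.
by rewrite -[k]/(nat_of_ord (Ordinal lt_kd)) !cpt_ord mxE.
Qed.

Lemma cptZ (s : R) v k : cpt (s *: v) k = s * cpt v k.
Proof.
have [lt_kd|le_dk] := ltnP k d; last by rewrite !cpt_oversize ?mulr0.
by rewrite -[k]/(nat_of_ord (Ordinal lt_kd)) !cpt_ord mxE.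
Qed.

Lemma cpt0 k : cpt 0 k = 0.
Proof. by rewrite -(scale0r 0) cptZ mul0r. Qed.

Lemma cpt_sum (I : Type) (r : seq I) (P : pred I) (F : I -> 'cV[R]_d) k :
  cpt (\sum_(i <- r | P i) F i) k = \sum_(i <- r | P i) cpt (F i) k.
Proof. by apply: (big_morph (cpt^~ k)) => [v w|]; rewrite ?cptD ?cpt0. Qed.

(** Each row has at most one nonzero entry. J, N and the block projections are all of this kind, and
    multiplying them amounts to composing index maps. *)
Definition wshift c f : 'M[R]_d := \matrix_(i, j) (c i *+ (j == f i :> nat)).

Lemma cpt_wshift c f v k :
  (k < d)%N -> cpt (wshift c f *m v) k = c k * cpt v (f k).
Proof.
move=> lt_kd; rewrite -[k]/(nat_of_ord (Ordinal lt_kd)) cpt_ord mxE /=.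
have [lt_fd|le_df] := ltnP (f k) d.
  rewrite (bigD1 (Ordinal lt_fd)) //= mxE eqxx big1 ?addr0 => [|j].
    by rewrite -cpt_ord.
  by rewrite -val_eqE mxE /= => /negPf ->; rewrite mul0r.
rewrite cpt_oversize // mulr0 big1 // => j _.
by rewrite mxE /= ltn_eqF ?mul0r // (leq_trans (ltn_ord j)).
Qed.

Lemma wshift_mul c f c' f' : (forall k, (k < d)%N -> (f k < d)%N) ->
  wshift c f *m wshift c' f' = wshift (fun k => c k * c' (f k)) (f' \o f).
Proof.
move=> f_lt; apply/matrixP => i j; rewrite mxE.
rewrite (bigD1 (Ordinal (f_lt _ (ltn_ord i)))) //= big1 ?addr0 => [|k].
  by rewrite !mxE eqxx /= mulrnAr.
by rewrite -val_eqE mxE /= => /negPf ->; rewrite mul0r.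
Qed.

(** Comparing [f] and [f'] only at nonzero weights disposes of the indices where subtraction
    truncates. *)
Lemma eq_wshift c f c' f' :
  (forall k, (k < d)%N -> c k = c' k) ->
  (forall k, (k < d)%N -> c k != 0 -> f k = f' k) -> wshift c f = wshift c' f'.
Proof.
move=> eqc eqf; apply/matrixP => i j; rewrite !mxE -eqc //.
have [->|c_neq0] := eqVneq (c i) 0; first by rewrite !mul0rn.
by rewrite eqf.
Qed.

Lemma wshift1 : wshift (fun=> 1) id = 1%:M.
Proof. by apply/matrixP => i j; rewrite !mxE eq_sym. Qed.

Lemma wshiftN c f : - wshift c f = wshift (fun k => - c k) f.
Proof. by apply/matrixP => i j; rewrite !mxE mulNrn. Qed.

(** Counting from 0, the other index of the 2 x 2 block containing [k]. *)
Definition swap (k : nat) : nat := if odd k then k.-1 else k.+1.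

Definition rotmx : 'M[R]_d := wshift (fun k => if odd k then 1 else -1) swap.

(** The weight kills rows 0 and 1, where the truncated [k - 2] would wrongly point to column 0. *)
Definition downmx : 'M[R]_d := wshift (fun k => (2 <= k)%:R) (subn^~ 2%N).

Definition blockmx (b : nat) : 'M[R]_d :=
  wshift (fun k => (k %/ 2 == b)%N%:R) id.

Lemma E4_trE (alpha beta : R) :
  (E4 d alpha beta)^T = alpha%:M + (beta *: rotmx + downmx).
Proof.
have inordE (b : bool) : inord b = (if b then ord_max else ord0) :> 'I_2.
  by apply/val_inj; rewrite /= inordK; case: b.
apply/matrixP => i j; rewrite !mxE !modn2 !inordE.
(* Every index condition is expressed by block numbers and parities, which leaves finitely many
   cases. *)
have -> : (i == j) = (i %/ 2 == j %/ 2)%N && (odd i == odd j).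
  rewrite -val_eqE /=; lia.
have -> : (j == swap i :> nat) = (i %/ 2 == j %/ 2)%N && (odd i != odd j).
  rewrite /swap; case: ifP; lia.
rewrite -mulrnA mulnb.
have -> : (2 <= i)%N && (j == i - 2 :> nat)%N =
          (i %/ 2 == (j %/ 2).+1)%N && (odd i == odd j) by lia.
have [->|_] := eqVneq (i %/ 2)%N (j %/ 2)%N; last first.
  rewrite /= mulr0n add0r mulr0n mulr0 add0r.
  have [_|_] := eqVneq (i %/ 2)%N (j %/ 2).+1; last by [].
  by rewrite /= mxE; case: (odd i); case: (odd j).
rewrite (ltn_eqF (ltnSn _)) /= addr0 mxE.
by case: (odd i); case: (odd j);
  rewrite /= ?mulr0 ?mulr1n ?mulr0n ?addr0 ?add0r ?mulr1 ?mulrN1.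
Qed.

Lemma rotmx_tr : rotmx^T = - rotmx.
Proof.
rewrite wshiftN; apply/matrixP => i j; rewrite !mxE.
have -> : (i == swap j :> nat) = (j == swap i :> nat).
  rewrite /swap; case: ifP; case: ifP; lia.
have [->|_] := eqVneq (j : nat) (swap i); last by rewrite !mulr0n.
rewrite /swap; have [oi|oi] := boolP (odd i).
  by have -> : odd i.-1 = false by lia.
by rewrite oddS oi opprK.
Qed.

Lemma downmxX k :
  downmx ^+ k = wshift (fun j => (2 * k <= j)%:R) (subn^~ (2 * k)%N).
Proof.
elim: k => [|k IHk].
  by rewrite expr0 -[1]wshift1; apply: eq_wshift => // j _ _; rewrite subn0.
rewrite exprS IHk -[LHS]/(_ *m _) wshift_mul => [|j]; last first.
  by apply: leq_ltn_trans; rewrite leq_subr.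
apply: eq_wshift => j _ /=; last by move=> _; lia.
by rewrite -natrM mulnb; congr (nat_of_bool _)%:R; lia.
Qed.

Lemma downmx_nilpotent : downmx ^+ d = 0.
Proof.
rewrite downmxX; apply/matrixP => i j; rewrite !mxE.
have -> : (2 * d <= i)%N = false by have := ltn_ord i; lia.
by rewrite mul0rn.
Qed.

Hypothesis d_even : ~~ odd d.

(** An even [d] leaves no incomplete block at the end. *)
Let swap_lt k : (k < d)%N -> (swap k < d)%N.
Proof. rewrite /swap; case: ifP; lia. Qed.

Lemma rotmx_sqr : rotmx *m rotmx = (-1)%:M.
Proof.
rewrite raddfN /= -wshift1 wshiftN wshift_mul //; apply: eq_wshift => k _.
  rewrite /swap; have [ok|ok] := boolP (odd k).
    have -> : odd k.-1 = false by lia.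
    by rewrite mul1r.
  by rewrite oddS ok mulr1.
by move=> _; rewrite /= /swap; case: ifP; case: ifP; lia.
Qed.

Lemma downmx_rotmx : downmx *m rotmx = rotmx *m downmx.
Proof.
rewrite !wshift_mul // => [|k]; last by apply: leq_ltn_trans; rewrite leq_subr.
apply: eq_wshift => k _ /=.
  have -> : (1 < swap k)%N = (1 < k)%N by rewrite /swap; case: ifP; lia.
  rewrite [RHS]mulrC; have [k2|k2] := leqP 2 k; last by rewrite !mul0r.
  by have -> : odd (k - 2) = odd k by lia.
have [k2 _|k2] := leqP 2 k; last by rewrite mul0r eqxx.
have odd_k2 : odd (k - 2) = odd k by lia.
by rewrite /swap odd_k2; case: ifP; lia.
Qed.

Lemma blockmx_rotmx b : blockmx b *m rotmx = rotmx *m blockmx b.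
Proof.
rewrite !wshift_mul //; apply: eq_wshift => k _ //=.
rewrite mulrC; congr (_ * _%:R); rewrite /swap; case: ifP; lia.
Qed.

End WeightedShift.

(** * Limits of powers and logarithms *)

Section RealLimits.
Variables (R : realType) (T : Type) (F : set_system T).
Context {FF : Filter F}.
Implicit Types (f : T -> R) (a b l p : R).

Lemma ler_norm_ln a b : 0 < a -> a <= b -> b <= 1 -> `|ln b| <= `|ln a|.
Proof.
move=> a_gt0 le_ab le_b1; have b_gt0 := lt_le_trans a_gt0 le_ab.
rewrite !ler0_norm ?ln_le0 // ?(le_trans le_ab) // lerN2 ler_ln //.
Qed.

(** With a = exp (- u), the bound (u / 2)^m / m! <= exp (u / 2) lets half of the exponential decay
    absorb u^m; the other half is the square root of a. *)
Lemma mulr_norm_lnX_le m : exists C : R, forall a, 0 <= a <= 1 ->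
  a * `|ln a| ^+ m <= C * Num.sqrt a.
Proof.
exists (2 ^+ m * m`!%:R) => a /andP[].
rewrite le_eqVlt => /predU1P[<-|a_gt0] a_le1.
  by rewrite mul0r mulr_ge0 ?sqrtr_ge0 // mulr_ge0 ?exprn_ge0.
set u := - ln a; have u_ge0 : 0 <= u by rewrite oppr_ge0 ln_le0.
have aE : a = expR (- u) by rewrite opprK lnK.
have -> : `|ln a| = u by rewrite -normrN ger0_norm.
have sqrt_a : Num.sqrt a = expR (- (u / 2)).
  rewrite -[RHS]ger0_norm ?expR_ge0 // -sqrtr_sqr expr2 -expRD aE.
  by congr (Num.sqrt (expR _)); field.
have u2 : (u / 2) ^+ m / m`!%:R <= expR (u / 2).
  case: m => [|m]; first by rewrite expr0 divr1 -expR0 ler_expR divr_ge0.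
  have u2_ge0 : 0 <= u / 2 by rewrite divr_ge0.
  by apply: le_trans (expR_ge1Dxn m u2_ge0); rewrite lerDr.
have -> : u ^+ m = 2 ^+ m * m`!%:R * ((u / 2) ^+ m / m`!%:R).
  rewrite expr_div_n; field.
  by rewrite expf_neq0 // pnatr_eq0 -lt0n fact_gt0.
rewrite sqrt_a {1}aE mulrCA ler_wpM2l ?mulr_ge0 ?exprn_ge0 //.
have -> : expR (- (u / 2)) = expR (- u) * expR (u / 2).
  by rewrite -expRD; congr expR; field.
by rewrite ler_wpM2l ?expR_ge0.
Qed.

Lemma cvg_mulr_norm_lnX f m : (forall x, 0 <= f x) ->
  f x @[x --> F] --> 0 -> f x * `|ln (f x)| ^+ m @[x --> F] --> 0.
Proof.
move=> f_ge0 cvgf; have [C leC] := mulr_norm_lnX_le m.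
apply: (@squeeze_cvgr _ _ _ _ (fun=> 0) (fun x => C * Num.sqrt (f x))).
- apply: filterS (cvgr_lt _ cvgf _ ltr01) => x f_lt1.
  apply/andP; split; first by rewrite mulr_ge0 ?exprn_ge0.
  by apply: leC; rewrite f_ge0 ltW.
- exact: cvg_cst.
rewrite -[X in _ --> X](mulr0 C) -sqrtr0; apply: cvgM; first exact: cvg_cst.
exact: (cvg_comp _ _ cvgf (@sqrt_continuous R 0)).
Qed.

Lemma cvg_powR_ge0 f l p : 0 < p -> (forall x, 0 <= f x) -> 0 <= l ->
  f x @[x --> F] --> l -> f x `^ p @[x --> F] --> l `^ p.
Proof.
move=> p_gt0 f_ge0; rewrite le_eqVlt => /predU1P[<-|l_gt0] cvgf.
  (* At [l = 0] the function [f] may itself take the value 0, so the right-hand limit of the power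
     is extended to the closed half-line. *)
  have h : a `^ p @[a --> 0^'+] --> 0 `^ p.
    by rewrite powR0 ?gt_eqF //; apply: powR_cvg0.
  move=> A /(cvg_at_right_within h) wA.
  change (F [set x | A (f x `^ p)]).
  by apply: (@filterS _ F _ _ _ _ (cvgf _ wA)) => x; apply.
have -> : l `^ p = expR (p * ln l) by rewrite /powR gt_eqF.
have h : expR (p * ln (f x)) @[x --> F] --> expR (p * ln l).
  apply: (cvg_comp _ expR _ (@continuous_expR R _)).
  apply: cvgM; first exact: cvg_cst.
  exact: (cvg_comp _ _ cvgf (continuous_ln l_gt0)).
apply: cvg_trans h; apply: near_eq_cvg.
apply: filterS (cvgr_gt _ cvgf _ l_gt0) => x f_gt0.
by rewrite /powR gt_eqF.
Qed.

End RealLimits.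

(** * The functions [Phi_i] *)

Section BlockNorm.
Variables (R : realType) (d : nat).
Hypothesis d_even : ~~ odd d.
Implicit Types (v xi : 'cV[R]_d) (s t : R).

Local Notation rotmx := (rotmx R d).
Local Notation downmx := (downmx R d).

Definition shear s : 'M[R]_d := expmx (s *: downmx).

Definition bnorm (b : nat) v : R :=
  Num.sqrt (cpt v (2 * b)%N ^+ 2 + cpt v (2 * b).+1 ^+ 2).

Lemma block_normE b v : block_norm b.+1 v = bnorm b v.
Proof.
rewrite /block_norm; have -> : (2 * b.+1 - 1 = (2 * b).+1)%N by lia.
by have -> : (2 * b.+1 = (2 * b).+2)%N by lia.
Qed.

(** The exponential series stops before [d] since N^d = 0, and N^k moves coordinate r - 2 k to place
    r. *)
Lemma cpt_shear s v r : (r < d)%N ->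
  cpt (shear s *m v) r =
  \sum_(0 <= k < d) s ^+ k / k`!%:R * ((2 * k <= r)%:R * cpt v (r - 2 * k)).
Proof.
move=> lt_rd; have sX k : (s *: downmx) ^+ k = s ^+ k *: downmx ^+ k.
  elim: k => [|k IHk]; first by rewrite !expr0 scale1r.
  rewrite !exprS IHk -scalerA -[LHS]/(_ *m _).
  by rewrite -scalemxAl -scalemxAr.
rewrite /shear (@expmx_nilpotent _ _ _ d) ?sX ?downmx_nilpotent ?scaler0 //.
rewrite mulmx_suml cpt_sum; apply: eq_bigr => k _.
by rewrite sX scalerA -scalemxAl cptZ downmxX cpt_wshift // [_^-1 * _]mulrC.
Qed.

Lemma shear0 : shear 0 = 1%:M.
Proof. by rewrite /shear scale0r expmx0. Qed.

Lemma shearD s t : shear (s + t) = shear s *m shear t.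
Proof. exact: expmxDZ. Qed.

Lemma bnorm_ge0 b v : 0 <= bnorm b v.
Proof. exact: sqrtr_ge0. Qed.

Lemma bnormZ b s v : bnorm b (s *: v) = `|s| * bnorm b v.
Proof.
by rewrite /bnorm !cptZ !exprMn -mulrDr sqrtrM ?sqr_ge0 // sqrtr_sqr.
Qed.

Lemma cpt_le_bnorm b v r : (r %/ 2 = b)%N -> `|cpt v r| <= bnorm b v.
Proof.
move=> rb; rewrite -sqrtr_sqr ler_wsqrtr //.
have [->|->] : (r = 2 * b \/ r = (2 * b).+1)%N by lia.
  by rewrite lerDl sqr_ge0.
by rewrite lerDr sqr_ge0.
Qed.

Lemma bnorm_eq0 b v :
  bnorm b v = 0 -> cpt v (2 * b)%N = 0 /\ cpt v (2 * b).+1 = 0.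
Proof.
by move=> v0; split; apply/normr0_eq0/le_anti;
  rewrite normr_ge0 andbT -v0 cpt_le_bnorm //; lia.
Qed.

(** All terms with k > 0 read coordinates of earlier blocks. This is what makes the two cases of
    [tau_step] agree. *)
Lemma cpt_shear_id s v i r : (forall k, (k < 2 * i)%N -> cpt v k = 0) ->
  (r %/ 2 = i)%N -> cpt (shear s *m v) r = cpt v r.
Proof.
move=> v0 ri; have [lt_rd|le_dr] := ltnP r d; last by rewrite !cpt_oversize.
rewrite cpt_shear // big_ltn; last by lia.
rewrite expr0 divr1 mul1r muln0 subn0 mul1r big_nat big1 ?addr0 // => k k_gt0.
have [le_kr|lt_rk] := leqP (2 * k) r; last by rewrite mul0r mulr0.
by rewrite v0 ?mulr0 //; lia.
Qed.

Lemma bnorm_shear_id s v i : (forall k, (k < 2 * i)%N -> cpt v k = 0) ->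
  bnorm i (shear s *m v) = bnorm i v.
Proof. by move=> v0; rewrite /bnorm !(cpt_shear_id s v0) //; lia. Qed.

(** Writing the squared norm as a quadratic form reduces rotation invariance to matrix algebra. *)
Lemma bnorm_sqr b v : (2 * b < d)%N ->
  bnorm b v ^+ 2 = (v^T *m (blockmx R d b *m v)) ord0 ord0.
Proof.
move=> lt_bd; rewrite sqr_sqrtr ?addr_ge0 ?sqr_ge0 // mxE.
have lt_bSd : ((2 * b).+1 < d)%N by lia.
rewrite (bigD1 (Ordinal lt_bd)) //= (bigD1 (Ordinal lt_bSd)) /=; last first.
  by rewrite -val_eqE /= gtn_eqF.
rewrite addrA big1 ?addr0; last first.
  move=> j; rewrite -!val_eqE /= => jb.
  by rewrite -cpt_ord cpt_wshift // (_ : _ == _ = false) ?mul0r ?mulr0 //; lia.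
rewrite ![v^T _ _]mxE -!cpt_ord !cpt_wshift //=.
have -> : ((2 * b) %/ 2 == b)%N by lia.
have -> : ((2 * b).+1 %/ 2 == b)%N by lia.
by rewrite !mul1r.
Qed.

(** J is skew-symmetric, so the transpose of exp (s J) is its inverse; it also commutes with the
    block projection, and thus cancels in the quadratic form. *)
Lemma bnorm_rot b s v : bnorm b (expmx (s *: rotmx) *m v) = bnorm b v.
Proof.
have [lt_bd|le_db] := ltnP (2 * b) d; last first.
  by rewrite /bnorm !cpt_oversize //; lia.
apply: (pexpIrn (n := 2)) => //; rewrite ?nnegrE ?bnorm_ge0 //.
rewrite !bnorm_sqr // trmx_mul -expmx_tr.
have -> : (s *: rotmx)^T = (- s) *: rotmx.
  by rewrite [LHS]linearZ /= rotmx_tr scalerN scaleNr.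
rewrite -mulmxA [in blockmx _ _ _ *m _]mulmxA expmx_comm; last first.
  by rewrite -scalemxAl -scalemxAr blockmx_rotmx.
rewrite -[_ *m _ *m v]mulmxA [expmx _ *m (_ *m _)]mulmxA.
by rewrite -expmxDZ addNr scale0r expmx0 mul1mx.
Qed.

Variables (alpha beta : R).

Lemma bnorm_expmx_E4 b t v :
  bnorm b (expmx (t *: (E4 d alpha beta)^T) *m v) =
  expR (t * alpha) * bnorm b (shear t *m v).
Proof.
rewrite E4_trE !scalerDr scalerA scale_scalar_mx expmxD; last first.
  by rewrite scalar_mxC.
rewrite expmx_scalar mul_scalar_mx -scalemxAl bnormZ (ger0_norm (expR_ge0 _)).
rewrite expmxD; last by apply: scalemx_comm; rewrite downmx_rotmx.
by rewrite -mulmxA bnorm_rot.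
Qed.

Lemma shear_E4 s :
  shear s *m (E4 d alpha beta)^T = (E4 d alpha beta)^T *m shear s.
Proof.
apply/esym/expmx_comm; rewrite E4_trE !mulmxDl !mulmxDr scalar_mxC.
congr (_ + (_ + _)); first by apply: scalemx_comm; rewrite downmx_rotmx.
by rewrite -scalemxAl -scalemxAr.
Qed.

Hypothesis alpha_gt0 : 0 < alpha.

(** * Recursion, zeros and homogeneity of [Phi] *)

Local Notation Phi := (@Defs.Phi R d alpha beta).

(** The time s for which exp (s E^t) is the matrix power of [Phi i xi] used in [tau_step]. *)
Definition Phi_time i xi : R := - (ln (Phi i xi) / alpha).

Lemma Phi_ge0 i xi : 0 <= Phi i xi.
Proof.
elim: i => [|[|i] IHi] //=; first exact: sqrtr_ge0.
by rewrite addr_ge0.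
Qed.

(* Both branches of [tau_step] are one formula, since [ln 0 = 0]. *)
Lemma Phi_recS i xi :
  (Phi i xi = 0 <-> forall k, (k < 2 * i)%N -> cpt xi k = 0) ->
  Phi i.+1 xi = Phi i xi + bnorm i (shear (Phi_time i xi) *m xi).
Proof.
case: i => [|i] Phi0.
  (* The dummy value [Phi 0 = 0] gives time 0, so the formula also yields [Phi 1]. *)
  by rewrite /Phi_time ln0 // mul0r oppr0 shear0 mul1mx add0r -block_normE.
rewrite -[Phi i.+2 xi]/
  (Phi i.+1 xi + `|tau_step alpha beta i.+2 (Phi i.+1 xi) xi|).
rewrite /tau_step.
have -> : [forall j : 'I_d, (j < 2 * i.+2 - 2)%N ==> (xi j ord0 == 0)] =
          (Phi i.+1 xi == 0).
  apply/forallP/eqP => [xi0|/Phi0 xi0 j].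
    apply/Phi0 => k lt_ki; have [lt_kd|le_dk] := ltnP k d; last first.
      by rewrite cpt_oversize.
    rewrite -[k]/(nat_of_ord (Ordinal lt_kd)) cpt_ord; apply/eqP.
    by apply: implyP (xi0 _) _ => /=; lia.
  by apply/implyP => lt_ji; rewrite -cpt_ord xi0 //; lia.
rewrite !block_normE; have [Phi_eq0|Phi_neq0] := eqVneq (Phi i.+1 xi) 0.
  rewrite bnorm_shear_id; last exact/Phi0.
  by rewrite ger0_norm ?bnorm_ge0.
have Phi_gt0 : 0 < Phi i.+1 xi by rewrite lt_def Phi_neq0 Phi_ge0.
rewrite /powmx -scaleNr scalerA.
have -> : ln (Phi i.+1 xi) * - alpha^-1 = Phi_time i.+1 xi by rewrite mulrN.
(* The scalar factor exp (s alpha) is the inverse of [Phi i.+1 xi] and cancels the factor in front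
   of the norm. *)
rewrite bnorm_expmx_E4 mulNr divfK ?gt_eqF // expRN lnK // mulVKf //.
by rewrite ger0_norm ?bnorm_ge0.
Qed.

(** The induction hypothesis is exactly the assumption of [Phi_recS]. Once the earlier coordinates
    vanish, the shear no longer affects block [i], and the added norm is that of the block
    itself. *)
Lemma Phi_eq0 i xi :
  Phi i xi = 0 <-> forall k, (k < 2 * i)%N -> cpt xi k = 0.
Proof.
elim: i => [|i IHi]; first by split.
rewrite (Phi_recS IHi); split => [/eqP|xi0].
  rewrite paddr_eq0 ?Phi_ge0 ?bnorm_ge0 // => /andP[/eqP/IHi xi0 /eqP].
  rewrite bnorm_shear_id // => /bnorm_eq0[xi1 xi2] k lt_ki.
  have [/xi0 //|le_ik] := ltnP k (2 * i).
  by have [->|->] : (k = 2 * i \/ k = (2 * i).+1)%N by lia.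
have xi0' k : (k < 2 * i)%N -> cpt xi k = 0 by move=> ?; apply: xi0; lia.
rewrite bnorm_shear_id // (IHi.2 xi0') add0r /bnorm !xi0; try lia.
by rewrite expr0n /= addr0 sqrtr0.
Qed.

Lemma PhiS i xi :
  Phi i.+1 xi = Phi i xi + bnorm i (shear (Phi_time i xi) *m xi).
Proof. exact/Phi_recS/Phi_eq0. Qed.

(** Multiplying [Phi i] by exp (t alpha) lowers [Phi_time] by [t], which compensates the shear by
    [t] contained in exp (t E^t). *)
Lemma Phi_homogeneous i t xi :
  Phi i (expmx (t *: (E4 d alpha beta)^T) *m xi) = expR (t * alpha) * Phi i xi.
Proof.
elim: i => [|i IHi]; first by rewrite mulr0.
rewrite !PhiS IHi mulrDr; congr (_ + _).
set M := expmx (_ *: _^T).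
have shearM s : bnorm i (shear s *m (M *m xi)) =
                expR (t * alpha) * bnorm i (shear (s + t) *m xi).
  have -> : shear s *m (M *m xi) = M *m (shear s *m xi).
    rewrite !mulmxA [shear s *m M]expmx_comm //.
    by rewrite -scalemxAl -scalemxAr shear_E4.
  by rewrite bnorm_expmx_E4 mulmxA -shearD addrC.
suff -> : bnorm i (shear (Phi_time i (M *m xi)) *m (M *m xi)) =
          expR (t * alpha) * bnorm i (shear (Phi_time i xi) *m xi) by [].
rewrite shearM; apply: (congr1 ( *%R _)).
(* If [Phi i xi = 0], the time stays at its default 0 and does not shift, but then no shear changes
   block [i]. *)
have [Phi0|Phi_neq0] := eqVneq (Phi i xi) 0.
  by rewrite !bnorm_shear_id //; apply/Phi_eq0.
have Phi_gt0 : 0 < Phi i xi by rewrite lt_def Phi_neq0 Phi_ge0.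
congr (bnorm i (shear _ *m xi)); rewrite /Phi_time IHi.
rewrite lnM ?posrE ?expR_gt0 // expRK.
by field; rewrite gt_eqF.
Qed.

(** * Continuity of [Phi] *)

Lemma continuous_cpt k : continuous (fun xi : 'cV[R]_d => cpt xi k).
Proof.
have [lt_kd|le_dk] := ltnP k d; last first.
  have -> : (fun xi : 'cV[R]_d => cpt xi k) = (fun=> 0).
    by apply/funext => xi; rewrite cpt_oversize.
  exact: cst_continuous.
have -> : (fun xi : 'cV[R]_d => cpt xi k) = (fun xi => xi (Ordinal lt_kd) ord0).
  by apply/funext => xi; rewrite -cpt_ord.
exact: coord_continuous.
Qed.

Lemma le_PhiS i xi : Phi i xi <= Phi i.+1 xi.
Proof. by rewrite PhiS lerDl bnorm_ge0. Qed.

Section LimitAtPoint.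
Variables (F : set_system 'cV[R]_d) (xi0 : 'cV[R]_d).
Context {FF : Filter F}.
Hypothesis cvg_cpt : forall k, cpt xi k @[xi --> F] --> cpt xi0 k.

(* The coordinates constrained by [Phi i] vanish faster than any power of
   [ln (Phi i)] blows up. *)
Definition ln_negligible i : Prop := forall m r,
  Phi i xi0 = 0 -> (r < 2 * i)%N ->
  `|ln (Phi i xi)| ^+ m * `|cpt xi r| @[xi --> F] --> 0.

Let coef k : R := (alpha ^+ k)^-1 / k`!%:R.

Let coef_ge0 k : 0 <= coef k.
Proof. by rewrite divr_ge0 // invr_ge0 exprn_ge0 // ltW. Qed.

Let norm_shear_term i k xi (c : R) : `|Phi_time i xi ^+ k / k`!%:R * c| =
  coef k * (`|ln (Phi i xi)| ^+ k * `|c|).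
Proof.
rewrite /Phi_time /coef !normrM normrX normrN normrM !normfV exprMn exprVn.
by rewrite (gtr0_norm alpha_gt0) (ger0_norm (ler0n _ _)); ring.
Qed.

(** The shear is expanded into its finitely many terms. Where [Phi i xi0] is nonzero, [ln] is
    continuous; where it is zero, a term with k > 0 is a power of the logarithm times an earlier
    coordinate, hence negligible. *)
Lemma cvg_cpt_shear i r : (r < d)%N -> (r %/ 2 = i)%N ->
  ln_negligible i -> Phi i xi @[xi --> F] --> Phi i xi0 ->
  cpt (shear (Phi_time i xi) *m xi) r @[xi --> F] -->
  cpt (shear (Phi_time i xi0) *m xi0) r.
Proof.
move=> lt_rd ri negl cPhi; rewrite cpt_shear //.
under eq_fun do rewrite cpt_shear //.
apply: cvgr_sum => k _.
have [le_kr|_] := leqP (2 * k) r; last first.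
  rewrite mul0r mulr0; under eq_fun do rewrite mul0r mulr0.
  exact: cvg_cst.
rewrite mul1r; under eq_fun do rewrite mul1r.
(* The term k = 0 is the coordinate of block [i] itself, to which [ln_negligible i] does not
   apply. *)
have [->|k_gt0] := posnP k.
  rewrite expr0; under eq_fun do rewrite expr0.
  by apply: cvgM; [apply: cvg_cst|apply: cvg_cpt].
have [Phi0|Phi_neq0] := eqVneq (Phi i xi0) 0; last first.
  have Phi_gt0 : 0 < Phi i xi0 by rewrite lt_def Phi_neq0 Phi_ge0.
  apply: cvgM; last exact: cvg_cpt.
  apply: cvgM; last exact: cvg_cst.
  have cvg_time : Phi_time i xi @[xi --> F] --> Phi_time i xi0.
    apply: cvgN; apply: cvgM; last exact: cvg_cst.
    exact: (cvg_comp _ _ cPhi (continuous_ln Phi_gt0)).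
  exact: (cvg_comp _ _ cvg_time (@exprn_continuous R k _)).
have xi0_0 : cpt xi0 (r - 2 * k) = 0 by apply: (Phi_eq0 i xi0).1 => //; lia.
rewrite xi0_0 mulr0; apply/norm_cvg0P.
have lt_ri : (r - 2 * k < 2 * i)%N by lia.
rewrite -[X in _ --> X](mulr0 (coef k)).
apply: cvg_eqfun (cvgM (cvg_cst _) (negl k _ Phi0 lt_ri)) => xi /=.
exact/esym/norm_shear_term.
Qed.

Lemma cvg_PhiS i : (2 * i.+1 <= d)%N ->
  ln_negligible i -> Phi i xi @[xi --> F] --> Phi i xi0 ->
  Phi i.+1 xi @[xi --> F] --> Phi i.+1 xi0.
Proof.
move=> le_id negl cPhi; rewrite PhiS; under eq_fun do rewrite PhiS.
apply: cvgD => //.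
have cvg_sqr r : (r < d)%N -> (r %/ 2 = i)%N ->
    cpt (shear (Phi_time i xi) *m xi) r ^+ 2 @[xi --> F] -->
    cpt (shear (Phi_time i xi0) *m xi0) r ^+ 2.
  move=> lt_rd ri; have h := cvg_cpt_shear lt_rd ri negl cPhi.
  exact: (cvg_comp _ _ h (@exprn_continuous R 2 _)).
apply: (cvg_comp _ Num.sqrt _ (@sqrt_continuous R _)).
by apply: cvgD; apply: cvg_sqr; lia.
Qed.

(** For earlier coordinates, passing from [Phi i] to the larger [Phi i.+1] only shrinks the
    logarithm near 0. A coordinate of block [i] equals its sheared value, at most [Phi i.+1], minus
    the terms k > 0; these are negligible with exponent k + m. *)
Lemma ln_negligibleS i : (2 * i.+1 <= d)%N -> ln_negligible i ->
  Phi i.+1 xi @[xi --> F] --> Phi i.+1 xi0 ->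
  ln_negligible i.+1.
Proof.
move=> le_id negl cPhiS m r PhiS0 lt_ri.
have xi0_0 := (Phi_eq0 i.+1 xi0).1 PhiS0.
have Phi0 : Phi i xi0 = 0 by apply/Phi_eq0 => k ?; apply: xi0_0; lia.
have cvgPhiS : Phi i.+1 xi @[xi --> F] --> 0 by rewrite -PhiS0.
have ln_le : \forall xi \near F, forall q, (q < 2 * i)%N ->
    `|ln (Phi i.+1 xi)| ^+ m * `|cpt xi q| <=
    `|ln (Phi i xi)| ^+ m * `|cpt xi q|.
  apply: filterS (cvgr_lt _ cvgPhiS _ ltr01) => xi PhiS_lt1 q lt_qi.
  (* At zeros of [Phi i] the default [ln 0 = 0] breaks the comparison of logarithms, but the
     coordinates vanish there. *)
  have [Phi_xi0|Phi_neq0] := eqVneq (Phi i xi) 0.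
    by rewrite ((Phi_eq0 i xi).1 Phi_xi0 q lt_qi) normr0 !mulr0.
  have Phi_gt0 : 0 < Phi i xi by rewrite lt_def Phi_neq0 Phi_ge0.
  by rewrite ler_wpM2r // lerXn2r ?nnegrE // ler_norm_ln ?le_PhiS // ltW.
have [lt_r2i|le_2ir] := ltnP r (2 * i).
  apply: (@squeeze_cvgr _ _ _ _ (fun=> 0) _ _ _ _ (cvg_cst _)
    (negl m r Phi0 lt_r2i)).
  by apply: filterS ln_le => xi /(_ r lt_r2i) ->; rewrite mulr_ge0 ?exprn_ge0.
pose term xi k := coef k *
  ((2 * k <= r)%:R * (`|ln (Phi i xi)| ^+ (k + m) * `|cpt xi (r - 2 * k)|)).
apply: (@squeeze_cvgr _ _ _ _ (fun=> 0) (fun xi =>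
  Phi i.+1 xi * `|ln (Phi i.+1 xi)| ^+ m + \sum_(1 <= k < d) term xi k)).
- apply: filterS ln_le => xi ln_le; apply/andP; split.
    by rewrite mulr_ge0 ?exprn_ge0.
  have lt_rd : (r < d)%N by lia.
  (* The shear formula is solved for its term k = 0, which is [cpt xi r]. *)
  have := cpt_shear (Phi_time i xi) xi lt_rd.
  move/(congr1 (fun x => x - \sum_(1 <= k < d) Phi_time i xi ^+ k / k`!%:R *
    ((2 * k <= r)%:R * cpt xi (r - 2 * k)))).
  rewrite [in RHS]big_ltn; last by lia.
  rewrite addrK expr0 divr1 mul1r muln0 subn0 mul1r => <-.
  rewrite (le_trans (ler_wpM2l _ (ler_normB _ _))) ?exprn_ge0 // mulrDr.
  apply: lerD.
    rewrite mulrC ler_wpM2r ?exprn_ge0 // PhiS.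
    apply: (le_trans (cpt_le_bnorm (b := i) _ _)); first by lia.
    by rewrite lerDr Phi_ge0.
  rewrite (le_trans (ler_wpM2l _ (ler_norm_sum _ _ _))) ?exprn_ge0 // mulr_sumr.
  rewrite big_nat [leRHS]big_nat; apply: ler_sum => k /andP[k_gt0 _].
  rewrite /term; have [le_kr|_] := leqP (2 * k) r; last first.
    by rewrite !mul0r !mulr0 normr0 mulr0.
  rewrite !mul1r norm_shear_term mulrCA ler_wpM2l //.
  rewrite exprD -mulrA mulrCA ler_wpM2l ?exprn_ge0 //.
  by apply: ln_le; lia.
- exact: cvg_cst.
rewrite -[X in _ --> X]addr0; apply: cvgD.
  exact: (cvg_mulr_norm_lnX m (Phi_ge0 i.+1) cvgPhiS).
rewrite -[X in _ --> X](_ : \sum_(1 <= k < d) 0 = 0); last by rewrite big1_eq.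
rewrite big_nat; under eq_fun do rewrite big_nat.
apply: cvgr_sum => k /andP[k_gt0 _]; rewrite /term.
have [le_kr|_] := leqP (2 * k) r; last first.
  under eq_fun do rewrite mul0r mulr0.
  exact: cvg_cst.
have lt_rki : (r - 2 * k < 2 * i)%N by lia.
rewrite -[X in _ --> X](mulr0 (coef k)).
apply: cvg_eqfun (cvgM (cvg_cst _) (negl (k + m)%N _ Phi0 lt_rki)) => xi.
by rewrite mul1r.
Qed.

End LimitAtPoint.

Lemma continuous_Phi i : (2 * i <= d)%N -> continuous (Phi i).
Proof.
move=> le_id xi0.
have cvg_cpt k : cpt xi k @[xi --> xi0] --> cpt xi0 k by apply: continuous_cpt.
suff [] : ln_negligible (nbhs xi0) xi0 i /\
          Phi i xi @[xi --> xi0] --> Phi i xi0 by [].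
elim: i le_id => [|i IHi] le_id; first by split; [|apply: cst_continuous].
have [|negl cPhi] := IHi; first by lia.
have FF : Filter (nbhs xi0) by apply: nbhs_filter.
have cPhiS := cvg_PhiS cvg_cpt le_id negl cPhi.
by split; [exact: (ln_negligibleS le_id negl (cPhiS FF))|exact: cPhiS].
Qed.

(** * Continuity, positivity and homogeneity of [rho4] *)

Lemma rho4_continuous : continuous (@rho4 R d alpha beta).
Proof.
move=> xi0; have inv_gt0 : 0 < alpha^-1 by rewrite invr_gt0.
have le_2d : (2 * (d %/ 2) <= d)%N by lia.
have cPhi : Phi (d %/ 2)%N xi @[xi --> nbhs xi0] --> Phi (d %/ 2)%N xi0.
  exact: continuous_Phi.
by have := cvg_powR_ge0 inv_gt0 (@Phi_ge0 _) (Phi_ge0 _ _) cPhi; apply.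
Qed.

Lemma rho4_gt0 xi : xi != 0 -> 0 < @rho4 R d alpha beta xi.
Proof.
move=> xi_neq0; apply: powR_gt0; rewrite lt_def Phi_ge0 andbT.
apply: contra_neq xi_neq0 => /Phi_eq0 xi0; apply/colP => k.
(* Since [d] is even, the d / 2 blocks exhaust all coordinates. *)
by rewrite mxE -cpt_ord; apply: xi0; have := ltn_ord k; lia.
Qed.

Lemma rho4_homogeneous (a : R) xi : 0 < a ->
  @rho4 R d alpha beta (powmx a (E4 d alpha beta)^T *m xi) =
  a * @rho4 R d alpha beta xi.
Proof.
move=> a_gt0; rewrite /rho4 /powmx Phi_homogeneous powRM ?expR_ge0 ?Phi_ge0 //.
by rewrite -expRM mulfK ?gt_eqF // lnK.
Qed.

End BlockNorm.

(** * Eigenvalues *)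

Lemma mulmx_eigenX (K : comPzRingType) (d : nat) (A : 'M[K]_d) (v : 'rV[K]_d)
    (c : K) (k : nat) :
  v *m A = c *: v -> v *m A ^+ k = c ^+ k *: v.
Proof.
move=> vA; elim: k => [|k IHk]; first by rewrite !expr0 mulmx1 scale1r.
by rewrite exprSr mulmxA IHk -scalemxAl vA scalerA -exprSr.
Qed.

(* [B = E^t - alpha] satisfies [B ^ 2 + beta ^ 2 = N (2 beta J + N)], which is
   nilpotent, so an eigenvalue [z] satisfies [(z - alpha) ^ 2 = - beta ^ 2]. *)
Lemma E4_tr_eigen_pos_re (R : realType) (d : nat) (alpha beta : R) :
  ~~ odd d -> 0 < alpha -> eigen_pos_re (E4 d alpha beta)^T.
Proof.
move=> d_even alpha_gt0 z /eigenvalueP[v vE v_neq0].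
pose J := rotmx R d; pose N := downmx R d.
pose B : 'M[R]_d := beta *: J + N.
pose K : 'M[R]_d := (2 * beta) *: J + N.
have NJ : N *m J = J *m N by apply: downmx_rotmx.
have sqrB : B *m B + (beta ^+ 2)%:M = N *m K.
  rewrite /B /K !mulmxDl !mulmxDr -!(scalemxAl, scalemxAr) rotmx_sqr // NJ.
  move: (J *m N) (N *m N) => X Y; apply/matrixP => i j; rewrite !mxE.
  by case: (i == j); rewrite ?mulr1n ?mulr0n; ring.
(* Commutation turns (N K)^d into N^d K^d, which is 0. *)
have NK : GRing.comm N K.
  suff : N *m K = K *m N by [].
  by rewrite mulmxDr mulmxDl -scalemxAr -scalemxAl NJ.
have NKd : (N *m K) ^+ d = 0.
  by rewrite -[N *m K]/(N * K) exprMn_comm // downmx_nilpotent mul0r.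
pose f (A : 'M[R]_d) := map_mx (real_complex R) A.
pose w := z - real_complex R alpha.
have vB : v *m f B = w *: v.
  move: vE; rewrite E4_trE map_mxD map_scalar_mx mulmxDr mul_mx_scalar => vE.
  by rewrite /w scalerBl -vE addrC addKr.
have vNK : v *m f (N *m K) = (w ^+ 2 + real_complex R (beta ^+ 2)) *: v.
  rewrite -sqrB /f map_mxD map_mxM map_scalar_mx mulmxDr mulmxA vB.
  by rewrite -scalemxAl vB scalerA mul_mx_scalar scalerDl.
have /eqP := mulmx_eigenX d vNK.
have fX k : f (N *m K) ^+ k = f ((N *m K) ^+ k).
  elim: k => [|k IHk]; first by rewrite /f map_mx1.
  by rewrite !exprS IHk -[LHS]/(_ *m _) -map_mxM.
rewrite fX NKd /f map_mx0 mulmx0 eq_sym scaler_eq0 (negPf v_neq0) orbF.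
rewrite expf_eq0 => /andP[_].
rewrite /w; case: z {vE vB vNK w} => a b.
rewrite eq_complex /= => /andP[/eqP re /eqP im].
(* The imaginary part gives (a - alpha) b = 0. If b = 0, the real part gives (a - alpha)^2 = -
   beta^2 <= 0. So the real part of every eigenvalue is [alpha]. *)
suff : a - alpha = 0 by move/subr0_eq ->.
have /eqP : (a - alpha) * b = 0 by lra.
rewrite mulf_eq0 => /orP[/eqP //|/eqP b0].
apply/eqP; rewrite -sqrf_eq0; apply/eqP; apply: le_anti; rewrite sqr_ge0 andbT.
by have := sqr_ge0 beta; move: re; rewrite b0; lra.
Qed.

Theorem lemma3p4 (R : realType) (d : nat) (alpha beta : R)
    (d_ge2 : (2 <= d)%N) (d_even : ~~ odd d) (alpha_gt0 : 0 < alpha) :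
  pseudo_norm (E4 d alpha beta)^T (@rho4 R d alpha beta).
Proof.
split.
- exact: E4_tr_eigen_pos_re.
- exact: rho4_continuous.
- exact: rho4_gt0.
- by move=> xi a; apply: rho4_homogeneous.
Qed.
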